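(* Let $A$ be a (noncommutative) algebra over a field $K$ of characteristic zero that satisfies the commutative centralizer condition, and let $C$ be a commutative subalgebra of $A$. The following statements are equivalent. (1) $C$ is a maximal commutative subalgebra of $A$. (2) There exists an element $a\in A\setminus Z(A)$ such that $C=C(a)$. (3) $C\ne Z(A)$ and $C=C(b)$ for all elements $b\in C\setminus Z(A)$. So, for each element $a\in A\setminus Z(A)$, its centralizer $C(a)$ is the unique maximal commutative subalgebra of $A$ that contains the element $a$.
   Context: $Z(A)$ is the centre of $A$ and $C(a)=\{b\in A: ab=ba\}$ is the centralizer of $a\in A$. A noncommutative algebra $A$ satisfies the commutative centralizer condition if the centralizer of each element of $A\setminus Z(A)$ is a commutative algebra.
   Formalization: In (3), ''C ≠ Z(A)'' is replaced by ''C is not contained in Z(A)''; as written, a subalgebra C strictly inside Z(A) satisfies (3) vacuously without being maximal, e.g. C = Q·1 in M_2(Q) × Q. *)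

(* Defs.v *)
From mathcomp Require Import all_boot all_algebra.
From mathcomp Require Import boolp classical_sets.

Set Implicit Arguments.
Unset Strict Implicit.
Unset Printing Implicit Defensive.

Import GRing.Theory.

Local Open Scope classical_set_scope.
Local Open Scope ring_scope.

(* Algebras are associative and unital (algType), possibly of infinite
   dimension; subalgebras contain 1. Subsets are Prop-valued since the centre
   of an arbitrary algebra is not a decidable predicate. *)

Definition centre (R : nzRingType) : set R :=
  [set z | forall x : R, GRing.comm z x].
Arguments centre R : clear implicits.

Definition centralizer (R : nzRingType) (a : R) : set R :=
  [set b | GRing.comm a b].

Definition commutative_on (R : nzRingType) (C : set R) : Prop :=
  forall x y : R, C x -> C y -> GRing.comm x y.

(* Noncommutativity of the ring is a separate hypothesis. *)
Definition commutative_centralizers (R : nzRingType) : Prop :=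
  forall a : R, (~` centre R) a -> commutative_on (centralizer a).

Section Subalgebras.
Variables (K : fieldType) (A : algType K).

Definition commutative_subalgebra (C : set A) : Prop :=
  GRing.subalg_closed [in C] /\ commutative_on C.

Definition maximal_commutative_subalgebra (C : set A) : Prop :=
  commutative_subalgebra C /\
  forall D : set A, commutative_subalgebra D -> C `<=` D -> D = C.

End Subalgebras.

(* Main.v *)
Require Import Defs.
From mathcomp Require Import all_boot all_algebra.
From mathcomp Require Import boolp classical_sets.

(** Among the noncentral elements of [A], commuting is an equivalence relation.
    Indeed, if [a] and [b] are noncentral and commute, then anything commuting
    with [a] commutes with [b], since both lie in the commutative set
    [centralizer a], and symmetrically; so [a] and [b] have the same centralizer
    ([centralizer_eq]).

    A commutative set containing [a] is contained in [centralizer a].  For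
    noncentral [a] the latter is itself a commutative subalgebra, hence the
    largest one containing [a]: it is maximal
    ([centralizer_maximal_commutative]), and every maximal one containing [a]
    equals it ([maximal_commutative_eq_centralizer]).  The equivalences follow
    once a maximal commutative subalgebra is known to have a noncentral element
    ([maximal_commutative_nsub_centre]); this is where noncommutativity of [A]
    is used. *)

Set Implicit Arguments.
Unset Strict Implicit.
Unset Printing Implicit Defensive.

Import GRing.Theory.

Local Open Scope classical_set_scope.
Local Open Scope ring_scope.

Section Centralizers.
Variable R : nzRingType.
Implicit Types (a b : R) (D : set R).

Lemma commutative_sub_centralizer D a :
  commutative_on D -> D a -> D `<=` centralizer a.
Proof. by move=> cD Da x Dx; apply: cD. Qed.

Lemma centre_sub_centralizer a : centre R `<=` centralizer a.
Proof. by move=> z Zz; apply/commr_sym/Zz. Qed.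

Lemma exists_noncentral :
  ~ commutative ( *%R : R -> R -> R) -> exists a, (~` centre R) a.
Proof.
move=> ncR; apply: contra_notP ncR => allZ x y.
by have /(_ y) : centre R x by apply: contrapT => nZx; apply: allZ; exists x.
Qed.

(** Each of the two centralizers is a commutative set containing the other
    element, hence lies in the centralizer of that element. *)
Lemma centralizer_eq a b : commutative_centralizers R ->
  (~` centre R) a -> (~` centre R) b -> centralizer a b ->
  centralizer a = centralizer b.
Proof.
move=> ccR nZa nZb ab; rewrite eqEsubset; split.
- exact: commutative_sub_centralizer (ccR _ nZa) ab.
- exact: commutative_sub_centralizer (ccR _ nZb) (commr_sym ab).
Qed.

End Centralizers.

Section MaximalCommutative.
Variables (K : fieldType) (A : algType K).
Implicit Types (a : A) (C D : set A).

Lemma centralizer_subalg_closed a : GRing.subalg_closed [in centralizer a].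
Proof.
split=> [|k u v|u v]; rewrite !inE.
- exact: commr1.
- move=> au av; apply: commrD => //.
  by rewrite /GRing.comm -scalerAr -scalerAl au.
- exact: commrM.
Qed.

Hypothesis ccA : commutative_centralizers A.

Lemma centralizer_commutative_subalgebra a :
  (~` centre A) a -> commutative_subalgebra (centralizer a).
Proof.
by move=> nZa; split; [exact: centralizer_subalg_closed | exact: ccA].
Qed.

Lemma centralizer_maximal_commutative a :
  (~` centre A) a -> maximal_commutative_subalgebra (centralizer a).
Proof.
move=> nZa; split=> [|D [_ cD] subD].
  exact: centralizer_commutative_subalgebra.
rewrite eqEsubset; split=> //.
by apply: commutative_sub_centralizer => //; apply: subD.
Qed.

Lemma maximal_commutative_eq_centralizer D a :
  maximal_commutative_subalgebra D -> (~` centre A) a -> D a ->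
  D = centralizer a.
Proof.
move=> [[_ cD] maxD] nZa Da; apply/esym/maxD.
- exact: centralizer_commutative_subalgebra.
- exact: commutative_sub_centralizer.
Qed.

(** A subalgebra inside the centre lies in the centralizer of any noncentral
    element, a commutative subalgebra; maximality would make the two equal and
    that noncentral element central. *)
Lemma maximal_commutative_nsub_centre C :
  ~ commutative ( *%R : A -> A -> A) -> maximal_commutative_subalgebra C ->
  ~ (C `<=` centre A).
Proof.
move=> /exists_noncentral[a nZa] [_ maxC] CZ; apply: (nZa); apply: (CZ).
rewrite -(maxC (centralizer a)) //.
- exact: centralizer_commutative_subalgebra.
- exact: subset_trans CZ (@centre_sub_centralizer _ a).
Qed.

End MaximalCommutative.

(* The third condition says that C is not contained in the centre, rather than
   merely distinct from it: otherwise a C strictly inside the centre satisfies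
   it vacuously without being maximal (C = rat embedded diagonally in
   M_2(rat) x rat). For C containing the centre the two readings coincide. *)
Theorem lemma4p1 (K : fieldType) (charK0 : [pchar K] =i pred0)
    (A : algType K) (ncA : ~ commutative ( *%R : A -> A -> A))
    (ccA : commutative_centralizers A) :
  (forall C : set A, commutative_subalgebra C ->
     [<-> maximal_commutative_subalgebra C;
          exists2 a : A, (~` centre A) a & C = centralizer a;
          ~ (C `<=` centre A) /\
          forall b : A, (C `\` centre A) b -> C = centralizer b])
  /\
  (forall a : A, (~` centre A) a ->
     [/\ maximal_commutative_subalgebra (centralizer a),
         centralizer a a
       & forall D : set A, maximal_commutative_subalgebra D -> D a ->
           D = centralizer a]).
Proof.
split=> [C _|a nZa]; last first.
  split=> //; first exact: centralizer_maximal_commutative.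
  by move=> D maxD Da; apply: maximal_commutative_eq_centralizer.
tfae.
- move=> maxC.
  have /nonsubset[c [Cc nZc]] := maximal_commutative_nsub_centre ccA ncA maxC.
  by exists c => //; apply: maximal_commutative_eq_centralizer.
- case=> a nZa ->; split=> [CZ|b [ab nZb]]; last exact: centralizer_eq.
  by apply: nZa; apply: CZ.
- case=> /nonsubset[b [Cb nZb]] /(_ b (conj Cb nZb)) ->.
  exact: centralizer_maximal_commutative.
Qed.
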